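(* Let $\{x(n)\}_{n\in\mathbb Z}$ be a cyclostationary process of period $P$ with cyclic PSD matrix $\mathbf S_X(\sigma)$, $\sigma\in[0,1/P)$. For each $\sigma\in[0,1/P)$ let $\mathbf b_X^{(p)}(\sigma)=[b_X^{(p)}(0,\sigma),\dots,b_X^{(p)}(P-1,\sigma)]^T$, $p=0,\dots,P-1$, be orthonormal eigenvectors of $\mathbf S_X(\sigma)$ with eigenvalues $\mathcal S_{\mathcal X}^{(p)}(\sigma)$: $$\mathbf S_X(\sigma)\mathbf b_X^{(p)}(\sigma)=\mathcal S_{\mathcal X}^{(p)}(\sigma)\mathbf b_X^{(p)}(\sigma).$$ Define, for $\lambda=\sigma+p/P\in[0,1)$, $$\phi(n,\lambda)=\phi^{(p)}_{\mathrm{CS}}(n,\sigma)=\sum_{q=0}^{P-1}b_X^{(p)}(q,\sigma)e^{j2\pi(\sigma+q/P)n},\qquad \mathcal S_{\mathcal X}(\lambda)=\mathcal S_{\mathcal X}^{(p)}(\sigma).$$ Then $\{\phi(n,\lambda)\}$ is a Karhunen–Loève eigenbasis of $\{x(n)\}$, i.e. it solves the eigenequation $$\sum_{l\in\mathbb Z}R_x(l,k-l)\,\phi(l,\lambda)=\mathcal S_{\mathcal X}(\lambda)\,\phi(k,\lambda)\quad\text{for all }k\in\mathbb Z,\ \lambda\in[0,1),$$ where the sum is understood as $\lim_{N\to\infty}\frac1N\sum_{l=-N/2}^{N/2-1}$ with $1/N\to d\lambda$ (so that both sides are interpreted as measures $\mathcal S_{\mathcal X}(\lambda)\phi(k,\lambda)\,d\lambda$);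 $\mathcal S_{\mathcal X}(\lambda)$ is the KL spectrum.
   Context: Let $\{x(n)\}_{n\in\mathbb Z}$ be a zero-mean, proper ($E[x(n)x(n+m)]=0$), second-order, harmonizable complex discrete-time random process with autocorrelation $R_x(n,m)=E[x(n+m)x^*(n)]$. It is cyclostationary (CS) of period $P\in\mathbb N$ if $R_x(n+lP,m)=R_x(n,m)$ for all $n,m,l\in\mathbb Z$. Its cyclic spectrum is $S_X^{(k/P)}(f)=\frac1P\sum_{n=0}^{P-1}\sum_{m\in\mathbb Z}R_x(n,m)e^{-j2\pi(kn/P+fm)}$ (indices $k$ taken modulo $P$). Its Cramér–Loève (CL) spectral increments are $d\nu_x(f)=\lim_{N\to\infty}\frac1N\sum_{n=-N/2}^{N/2-1}x(n)e^{-j2\pi fn}$, $f\in[0,1)$, so that $x(n)=\int_0^1e^{j2\pi fn}d\nu_x(f)$, and for a CS process $E[d\nu_x(f)d\nu_x^*(f-\alpha)]=\sum_{k=0}^{P-1}S_X^{(k/P)}(f)\delta(\alpha-k/P)\,d\alpha\,df$. The cyclic PSD matrix $\mathbf S_X(\sigma)\in\mathbb C^{P\times P}$, $\sigma\in[0,1/P)$, has entries $[\mathbf S_X(\sigma)]_{r,c}=S_X^{((r-c)/P)}(\sigma+r/P)$, $r,c\in\{0,\dots,P-1\}$; it is Hermitian nonnegative definite. *)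

(* Defs.v *)
From Stdlib Require Import Reals ZArith List.
From Coquelicot Require Import Coquelicot.
Import ListNotations.

Definition cexpi (x : R) : C := (cos x, sin x).

Definition fsum (n : nat) (f : nat -> C) : C :=
  fold_right Cplus (RtoC 0) (map f (seq 0 n)).

Definition zsum (a b : Z) (f : Z -> C) : C :=
  fsum (Z.to_nat (b - a)) (fun i => f (a + Z.of_nat i)%Z).

Definition sym_partial (f : Z -> C) (N : nat) : C :=
  zsum (- Z.of_nat N)%Z (Z.of_nat N) f.

(* "sum_{l in Z} f l = v", as the limit of the symmetric partial sums
   sum_{l=-N}^{N-1} (the convention of the paper) *)
Definition zseries_to (f : Z -> C) (v : C) : Prop :=
  filterlim (sym_partial f) eventually (locally v).

Definition zseries (f : Z -> C) : C :=
  (real (Lim_seq (fun N => fst (sym_partial f N))),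
   real (Lim_seq (fun N => snd (sym_partial f N)))).

Definition abs_summable_Z (g : Z -> C) : Prop :=
  ex_series (fun i => Cmod (g (Z.of_nat i))) /\
  ex_series (fun i => Cmod (g (- Z.of_nat i)%Z)).

(* R_x(n,m) = E[x(n+m) x^*(n)] is cyclostationary of period P *)
Definition cyclostationary (Rx : Z -> Z -> C) (P : nat) : Prop :=
  forall n m l : Z, Rx (n + l * Z.of_nat P)%Z m = Rx n m.

Definition cyc_spec (Rx : Z -> Z -> C) (P : nat) (k : Z) (f : R) : C :=
  Cmult (RtoC (/ INR P))
    (fsum P (fun n =>
       zseries (fun m =>
         Cmult (Rx (Z.of_nat n) m)
               (cexpi (- (2 * PI * (IZR k * INR n / INR P + f * IZR m))))))).

Definition cyc_psd_mx (Rx : Z -> Z -> C) (P : nat) (sigma : R) (r c : nat) : C :=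
  cyc_spec Rx P (Z.of_nat r - Z.of_nat c)%Z (sigma + INR r / INR P).

Definition phiCS (bp : nat -> C) (P : nat) (sigma : R) (n : Z) : C :=
  fsum P (fun q => Cmult (bp q) (cexpi (2 * PI * (sigma + INR q / INR P) * IZR n))).

(* Main.v *)
(* Write the eigenequation in the lag variable m = k - l.  Expanding the matrix
   S_X(sigma) and the wave e^{j 2 pi (sigma + r/P) k} in sum_r e^{j 2 pi (sigma + r/P) k}
   [S_X(sigma) b]_r, the sum over r of P-th roots of unity collapses the time index n of
   the cyclic spectrum onto the residue of k - m modulo P; by cyclostationarity the m-th
   lag term becomes exactly R_x(k - m, m) phi(k - m).  Summing over m and using the
   eigenvector equation gives S(lambda) phi(k, lambda).  Absolute summability of R_x(n, .)
   makes every lag series converge and its terms vanish at infinity, which is what allows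
   the symmetric partial sums to be reindexed by l = k - m. *)

Require Import Defs.
From Stdlib Require Import Reals ZArith List Lia Lra.
From Coquelicot Require Import Coquelicot.
Open Scope C_scope.

Lemma fsum_0 f : fsum 0 f = 0.
Proof. reflexivity. Qed.

Lemma fsum_S n f : fsum (S n) f = fsum n f + f n.
Proof.
  unfold fsum. rewrite seq_S, map_app, fold_right_app. simpl.
  induction (map f (seq 0 n)) as [|a l IHl]; simpl; [ring|].
  rewrite IHl. ring.
Qed.

Lemma fsum_Sl n f : fsum (S n) f = f O + fsum n (fun i => f (S i)).
Proof.
  induction n as [|n IHn].
  - rewrite fsum_S, !fsum_0. ring.
  - rewrite fsum_S, IHn, fsum_S. ring.
Qed.

Lemma fsum_ext n f g : (forall i, (i < n)%nat -> f i = g i) -> fsum n f = fsum n g.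
Proof.
  induction n as [|n IHn]; intros H; auto.
  rewrite !fsum_S, IHn, (H n) by (lia || (intros; apply H; lia)). reflexivity.
Qed.

Lemma fsum_plus n f g : fsum n (fun i => f i + g i) = fsum n f + fsum n g.
Proof. induction n as [|n IHn]; [rewrite !fsum_0; ring|]. rewrite !fsum_S, IHn. ring. Qed.

Lemma fsum_mult_l n c f : fsum n (fun i => c * f i) = c * fsum n f.
Proof. induction n as [|n IHn]; [rewrite !fsum_0; ring|]. rewrite !fsum_S, IHn. ring. Qed.

Lemma fsum_mult_r n c f : fsum n (fun i => f i * c) = fsum n f * c.
Proof. induction n as [|n IHn]; [rewrite !fsum_0; ring|]. rewrite !fsum_S, IHn. ring. Qed.

Lemma fsum_const n c : fsum n (fun _ => c) = RtoC (INR n) * c.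
Proof.
  induction n as [|n IHn]; [rewrite fsum_0; simpl; ring|].
  rewrite fsum_S, IHn, S_INR, RtoC_plus. ring.
Qed.

Lemma fsum_swap n m (F : nat -> nat -> C) :
  fsum n (fun i => fsum m (fun j => F i j)) = fsum m (fun j => fsum n (fun i => F i j)).
Proof.
  induction n as [|n IHn].
  - rewrite fsum_0, (fsum_ext m _ (fun _ => 0)) by (intros; apply fsum_0).
    rewrite fsum_const. ring.
  - rewrite fsum_S, IHn, <- fsum_plus. apply fsum_ext. intros. rewrite fsum_S. auto.
Qed.

Lemma fsum_delta n j (x : C) : (j < n)%nat ->
  fsum n (fun i => if Nat.eqb i j then x else 0) = x.
Proof.
  induction n as [|n IHn]; intros H; [lia|].
  rewrite fsum_S. destruct (Nat.eq_dec j n) as [->|Hjn].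
  - rewrite Nat.eqb_refl, (fsum_ext _ _ (fun _ => 0)), fsum_const; [ring|].
    intros i Hi. destruct (Nat.eqb_spec i n); [lia|auto].
  - rewrite IHn by lia. destruct (Nat.eqb_spec n j); [lia|]. ring.
Qed.

Lemma cexpi_add a b : cexpi a * cexpi b = cexpi (a + b).
Proof. unfold cexpi, Cmult; simpl. rewrite cos_plus, sin_plus. f_equal; ring. Qed.

Lemma Cmod_cexpi x : Cmod (cexpi x) = 1%R.
Proof.
  unfold Cmod, cexpi. cbn [fst snd].
  replace (cos x ^ 2 + sin x ^ 2)%R with 1%R; [apply sqrt_1|].
  rewrite <- (sin2_cos2 x). unfold Rsqr. ring.
Qed.

Lemma cexpi_0 : cexpi 0 = 1.
Proof. unfold cexpi. rewrite cos_0, sin_0. reflexivity. Qed.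

Lemma cexpi_2PI_IZR z : cexpi (2 * PI * IZR z) = 1.
Proof.
  unfold cexpi. destruct (Z_le_gt_dec 0 z) as [Hz|Hz].
  - rewrite <- (Z2Nat.id z Hz), <- INR_IZR_INZ.
    replace (2 * PI * INR (Z.to_nat z))%R with (0 + 2 * INR (Z.to_nat z) * PI)%R by ring.
    rewrite cos_period, sin_period, cos_0, sin_0. reflexivity.
  - replace (2 * PI * IZR z)%R with (- (0 + 2 * INR (Z.to_nat (- z)) * PI))%R.
    + rewrite cos_neg, sin_neg, cos_period, sin_period, cos_0, sin_0.
      unfold RtoC. f_equal. ring.
    + rewrite INR_IZR_INZ, Z2Nat.id, opp_IZR by lia. ring.
Qed.

Lemma cexpi_periodic x z : cexpi (x + 2 * PI * IZR z) = cexpi x.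
Proof. rewrite <- cexpi_add, cexpi_2PI_IZR. ring. Qed.

Lemma cexpi_root_neq1 (P : nat) (t : Z) : (0 < t < Z.of_nat P)%Z ->
  cexpi (2 * PI * IZR t / INR P) <> 1.
Proof.
  intros Ht E. unfold cexpi in E. injection E as Ecos Esin.
  assert (HP : (0 < INR P)%R) by (rewrite INR_IZR_INZ; apply IZR_lt; lia).
  assert (HtP : (IZR t < INR P)%R) by (rewrite INR_IZR_INZ; apply IZR_lt; lia).
  assert (Ht0 : (0 < IZR t)%R) by (apply IZR_lt; lia).
  set (th := (2 * PI * IZR t / INR P)%R) in *.
  assert (Hth0 : (0 < th)%R).
  { unfold th. apply Rdiv_lt_0_compat; [|lra]. generalize PI_RGT_0; nra. }
  assert (Hth2 : (th < 2 * PI)%R).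
  { unfold th. apply Rmult_lt_reg_r with (INR P); [lra|].
    unfold Rdiv. rewrite Rmult_assoc, Rinv_l by lra. generalize PI_RGT_0; nra. }
  destruct (Rtotal_order th PI) as [L|[L|L]].
  - generalize (sin_gt_0 th Hth0 L). lra.
  - rewrite L, cos_PI in Ecos. lra.
  - generalize (sin_lt_0 th L Hth2). lra.
Qed.

(* A geometric sum with ratio w <> 1 and w^P = 1 is fixed by multiplication by w, hence 0. *)
Lemma fsum_roots_of_unity (P : nat) (j : Z) : (0 < P)%nat ->
  fsum P (fun r => cexpi (2 * PI * INR r * IZR j / INR P)) =
  if Z.eqb (j mod Z.of_nat P) 0 then RtoC (INR P) else 0.
Proof.
  intros HP.
  assert (HPz : (0 < Z.of_nat P)%Z) by lia.
  assert (HPr : (INR P <> 0)%R) by (apply not_0_INR; lia).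
  set (w := cexpi (2 * PI * IZR j / INR P)).
  set (term := fun r => cexpi (2 * PI * INR r * IZR j / INR P)).
  assert (Hstep : forall r, term (S r) = w * term r).
  { intros r. unfold term, w. rewrite cexpi_add, S_INR. f_equal. field. auto. }
  assert (Hterm0 : term O = 1).
  { unfold term. rewrite <- cexpi_0. f_equal. simpl. field. auto. }
  assert (HtermP : term P = 1).
  { unfold term. rewrite <- cexpi_0, <- (cexpi_periodic 0 j). f_equal. field. auto. }
  destruct (Z.eqb_spec (j mod Z.of_nat P) 0) as [E|E].
  - rewrite (fsum_ext _ _ (fun _ => 1)), fsum_const; [ring|].
    intros r _. unfold term. rewrite (Z.div_mod j (Z.of_nat P)), E, Z.add_0_r by lia.
    rewrite <- cexpi_0, <- (cexpi_periodic 0 (Z.of_nat r * (j / Z.of_nat P))).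
    f_equal. rewrite !mult_IZR, <- !INR_IZR_INZ. field. auto.
  - change (fsum P term = 0).
    assert (Hfix : w * fsum P term = fsum P term).
    { rewrite <- fsum_mult_l, (fsum_ext _ _ (fun r => term (S r)))
        by (intros; symmetry; apply Hstep).
      generalize (fsum_Sl P term) (fsum_S P term). rewrite Hterm0, HtermP.
      intros A B. rewrite B in A. apply (f_equal (fun z => z - 1)) in A.
      replace (fsum P term + 1 - 1) with (fsum P term) in A by ring. rewrite A. ring. }
    assert (Hw : w - 1 <> 0).
    { intros E'. apply (cexpi_root_neq1 P (j mod Z.of_nat P)).
      - generalize (Z.mod_pos_bound j (Z.of_nat P) HPz). lia.
      - rewrite <- (cexpi_periodic _ (j / Z.of_nat P)).
        replace (2 * PI * IZR (j mod Z.of_nat P) / INR P + 2 * PI * IZR (j / Z.of_nat P))%R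
          with (2 * PI * IZR j / INR P)%R.
        + fold w. replace w with (w - 1 + 1) by ring. rewrite E'. ring.
        + rewrite (Z.div_mod j (Z.of_nat P)) at 1 by lia.
          rewrite plus_IZR, mult_IZR, <- INR_IZR_INZ. field. auto. }
    replace (fsum P term) with (/ (w - 1) * (w * fsum P term - fsum P term))
      by (field; exact Hw).
    rewrite Hfix. ring.
Qed.
Lemma sub_mod_eqb_0 (P : nat) (d : Z) (n : nat) : (0 < P)%nat -> (n < P)%nat ->
  Z.eqb ((d - Z.of_nat n) mod Z.of_nat P) 0 = Nat.eqb n (Z.to_nat (d mod Z.of_nat P)).
Proof.
  intros HP Hn. assert (HPz : (0 < Z.of_nat P)%Z) by lia.
  set (n0 := (d mod Z.of_nat P)%Z).
  assert (B := Z.mod_pos_bound d (Z.of_nat P) HPz). fold n0 in B.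
  rewrite <- Zminus_mod_idemp_l. fold n0.
  rewrite <- (Z_mod_plus_full (n0 - Z.of_nat n) 1).
  destruct (Z.eq_dec n0 (Z.of_nat n)) as [E|E].
  - rewrite E, Nat2Z.id, Nat.eqb_refl.
    replace (Z.of_nat n - Z.of_nat n + 1 * Z.of_nat P)%Z with (1 * Z.of_nat P)%Z by lia.
    rewrite Z_mod_mult. reflexivity.
  - destruct (Nat.eqb_spec n (Z.to_nat n0)); [lia|].
    destruct (Z_lt_le_dec n0 (Z.of_nat n)).
    + rewrite Z.mod_small by lia. apply Z.eqb_neq. lia.
    + rewrite <- (Z_mod_plus_full (n0 - Z.of_nat n + 1 * Z.of_nat P) (-1)).
      rewrite Z.mod_small by lia. apply Z.eqb_neq. lia.
Qed.

(* Orthogonality of the characters of Z/PZ: the normalized root sum is the indicator of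
   [n = d mod P], so it sifts out a single term. *)
Lemma fsum_sift_residue (P : nat) (d : Z) (F : nat -> C) : (0 < P)%nat ->
  fsum P (fun n => F n * (RtoC (/ INR P) *
    fsum P (fun r => cexpi (2 * PI * INR r * IZR (d - Z.of_nat n) / INR P)))) =
  F (Z.to_nat (d mod Z.of_nat P)).
Proof.
  intros HP. assert (HPr : (INR P <> 0)%R) by (apply not_0_INR; lia).
  rewrite (fsum_ext _ _ (fun n => if Nat.eqb n (Z.to_nat (d mod Z.of_nat P))
                                  then F (Z.to_nat (d mod Z.of_nat P)) else 0)).
  - apply fsum_delta.
    generalize (Z.mod_pos_bound d (Z.of_nat P) ltac:(lia)). lia.
  - intros n Hn. rewrite fsum_roots_of_unity, sub_mod_eqb_0 by assumption.
    destruct (Nat.eqb_spec n (Z.to_nat (d mod Z.of_nat P))) as [->|_]; [|ring].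
    rewrite <- RtoC_mult, Rinv_l by exact HPr. ring.
Qed.

Definition is_lim_Cseq (u : nat -> C) (v : C) : Prop :=
  is_lim_seq (fun N => fst (u N)) (fst v) /\ is_lim_seq (fun N => snd (u N)) (snd v).

Lemma is_lim_Cseq_filterlim u v : filterlim u eventually (locally v) <-> is_lim_Cseq u v.
Proof.
  split.
  - intros H; split; intros Q [eps HQ].
    + apply (H (fun z => Q (fst z))). exists eps. intros y [Hy1 Hy2]; apply HQ; auto.
    + apply (H (fun z => Q (snd z))). exists eps. intros y [Hy1 Hy2]; apply HQ; auto.
  - intros [H1 H2] Q [eps HQ].
    assert (E1 := H1 (ball (fst v) eps) (locally_ball _ _)).
    assert (E2 := H2 (ball (snd v) eps) (locally_ball _ _)).
    unfold filtermap in E1, E2. change (eventually (fun x => Q (u x))).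
    generalize (filter_and _ _ E1 E2). apply filter_imp. intros x [A B]. apply HQ. split; auto.
Qed.

Lemma zseries_unique f v : zseries_to f v -> zseries f = v.
Proof.
  unfold zseries_to. rewrite is_lim_Cseq_filterlim. intros [H1 H2]. unfold zseries.
  rewrite (is_lim_seq_unique _ _ H1), (is_lim_seq_unique _ _ H2). destruct v; reflexivity.
Qed.

Lemma is_lim_Cseq_ext u w v : (forall N, u N = w N) -> is_lim_Cseq u v -> is_lim_Cseq w v.
Proof.
  intros E [H1 H2]; split; eapply is_lim_seq_ext; try eassumption; intros; simpl; rewrite E; auto.
Qed.

Lemma is_lim_Cseq_incr_1 u v : is_lim_Cseq (fun N => u (S N)) v -> is_lim_Cseq u v.
Proof. intros [H1 H2]; split; apply is_lim_seq_incr_1; assumption. Qed.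

Lemma is_lim_Cseq_const c : is_lim_Cseq (fun _ => c) c.
Proof. split; apply is_lim_seq_const. Qed.

Lemma is_lim_Cseq_plus u w a b :
  is_lim_Cseq u a -> is_lim_Cseq w b -> is_lim_Cseq (fun N => u N + w N) (a + b).
Proof. intros [H1 H2] [H3 H4]; split; apply is_lim_seq_plus'; assumption. Qed.

Lemma is_lim_Cseq_scal_l c u a : is_lim_Cseq u a -> is_lim_Cseq (fun N => c * u N) (c * a).
Proof.
  intros [H1 H2]; destruct c as [c1 c2]; split; simpl.
  - apply is_lim_seq_minus'; apply (is_lim_seq_scal_l _ _ (Finite _)); assumption.
  - apply is_lim_seq_plus'; apply (is_lim_seq_scal_l _ _ (Finite _)); assumption.
Qed.

Lemma is_lim_Cseq_scal_r c u a : is_lim_Cseq u a -> is_lim_Cseq (fun N => u N * c) (a * c).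
Proof.
  intros H. rewrite Cmult_comm. apply (is_lim_Cseq_ext (fun N => c * u N)).
  - intros; apply Cmult_comm.
  - apply is_lim_Cseq_scal_l; assumption.
Qed.

Lemma is_lim_Cseq_fsum n (U : nat -> nat -> C) V :
  (forall i, (i < n)%nat -> is_lim_Cseq (U i) (V i)) ->
  is_lim_Cseq (fun N => fsum n (fun i => U i N)) (fsum n V).
Proof.
  induction n as [|n IHn]; intros H.
  - apply is_lim_Cseq_const.
  - rewrite fsum_S. apply (is_lim_Cseq_ext (fun N => fsum n (fun i => U i N) + U n N)).
    + intros; rewrite fsum_S; reflexivity.
    + apply is_lim_Cseq_plus; [apply IHn; intros; apply H|apply H]; lia.
Qed.

Lemma Rabs_fst_le_Cmod z : (Rabs (fst z) <= Cmod z)%R.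
Proof. eapply Rle_trans; [apply Rmax_l|apply Rmax_Cmod]. Qed.

Lemma Rabs_snd_le_Cmod z : (Rabs (snd z) <= Cmod z)%R.
Proof. eapply Rle_trans; [apply Rmax_r|apply Rmax_Cmod]. Qed.

Lemma is_lim_Cseq_Cmod_0 u : is_lim_seq (fun N => Cmod (u N)) 0%R -> is_lim_Cseq u 0.
Proof.
  intros H. split; apply is_lim_seq_abs_0;
    apply (is_lim_seq_le_le (fun _ => 0%R) _ (fun N => Cmod (u N))); auto using is_lim_seq_const;
    intros N; split; auto using Rabs_pos, Rabs_fst_le_Cmod, Rabs_snd_le_Cmod.
Qed.

Lemma sym_partial_0 f : sym_partial f 0 = 0.
Proof. reflexivity. Qed.

Lemma sym_partial_unfold f N :
  sym_partial f N = fsum (N + N) (fun i => f (- Z.of_nat N + Z.of_nat i)%Z).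
Proof. unfold sym_partial, zsum. f_equal. lia. Qed.

Lemma sym_partial_ext f g N : (forall z, f z = g z) -> sym_partial f N = sym_partial g N.
Proof. intros H. rewrite !sym_partial_unfold. apply fsum_ext. intros; apply H. Qed.

Lemma sym_partial_S f N :
  sym_partial f (S N) = sym_partial f N + f (- Z.of_nat (S N))%Z + f (Z.of_nat N).
Proof.
  rewrite !sym_partial_unfold. replace (S N + S N)%nat with (S (S (N + N))) by lia.
  rewrite fsum_Sl, fsum_S.
  replace (- Z.of_nat (S N) + Z.of_nat 0)%Z with (- Z.of_nat (S N))%Z by lia.
  replace (- Z.of_nat (S N) + Z.of_nat (S (N + N)))%Z with (Z.of_nat N) by lia.
  rewrite (fsum_ext _ (fun i => f (- Z.of_nat (S N) + Z.of_nat (S i))%Z)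
     (fun i => f (- Z.of_nat N + Z.of_nat i)%Z)) by (intros; f_equal; lia).
  ring.
Qed.

Lemma sym_partial_mult_l c f N : sym_partial (fun m => c * f m) N = c * sym_partial f N.
Proof. rewrite !sym_partial_unfold. apply fsum_mult_l. Qed.

Lemma sym_partial_mult_r c f N : sym_partial (fun m => f m * c) N = sym_partial f N * c.
Proof. rewrite !sym_partial_unfold. apply fsum_mult_r. Qed.

Lemma sym_partial_fsum n (F : nat -> Z -> C) N :
  sym_partial (fun m => fsum n (fun i => F i m)) N = fsum n (fun i => sym_partial (F i) N).
Proof.
  rewrite sym_partial_unfold, fsum_swap. apply fsum_ext. intros. rewrite sym_partial_unfold.
  reflexivity.
Qed.

Lemma sym_partial_pairs f N :
  sym_partial f N = fsum N (fun i => f (Z.of_nat i) + f (- Z.of_nat (S i))%Z).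
Proof. induction N as [|N IHN]; [reflexivity|]. rewrite sym_partial_S, fsum_S, IHN. ring. Qed.

Lemma sym_partial_shift_1 f N : sym_partial (fun l => f (l + 1)%Z) N =
  sym_partial f N - f (- Z.of_nat N)%Z + f (Z.of_nat N).
Proof.
  induction N as [|N IHN]; [rewrite !sym_partial_0; simpl; ring|].
  rewrite !sym_partial_S, IHN.
  replace (- Z.of_nat (S N) + 1)%Z with (- Z.of_nat N)%Z by lia.
  replace (Z.of_nat N + 1)%Z with (Z.of_nat (S N)) by lia. ring.
Qed.

Lemma sym_partial_opp f N : sym_partial (fun l => f (- l)%Z) N =
  sym_partial f N - f (- Z.of_nat N)%Z + f (Z.of_nat N).
Proof.
  induction N as [|N IHN]; [rewrite !sym_partial_0; simpl; ring|].
  rewrite !sym_partial_S, IHN, Z.opp_involutive. ring.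
Qed.

Definition vanishes_at_infinity (f : Z -> C) : Prop :=
  forall eps, (0 < eps)%R -> exists M : Z, forall z, (M <= Z.abs z)%Z -> (Cmod (f z) < eps)%R.

Lemma vanishes_at_infinity_le f h : (forall z, (Cmod (h z) <= Cmod (f z))%R) ->
  vanishes_at_infinity f -> vanishes_at_infinity h.
Proof.
  intros B H eps He. destruct (H eps He) as [M HM]. exists M. intros z Hz.
  specialize (B z). specialize (HM z Hz). lra.
Qed.

Lemma vanishes_at_infinity_shift f j :
  vanishes_at_infinity f -> vanishes_at_infinity (fun l => f (l + j)%Z).
Proof.
  intros H eps He. destruct (H eps He) as [M HM]. exists (M + Z.abs j)%Z.
  intros z Hz. apply HM. lia.
Qed.

Lemma vanishes_at_infinity_opp f :
  vanishes_at_infinity f -> vanishes_at_infinity (fun l => f (- l)%Z).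
Proof.
  intros H eps He. destruct (H eps He) as [M HM]. exists M. intros z Hz. apply HM. lia.
Qed.

Lemma vanishes_at_infinity_plus f g : vanishes_at_infinity f -> vanishes_at_infinity g ->
  vanishes_at_infinity (fun z => f z + g z).
Proof.
  intros Hf Hg eps He. destruct (Hf (eps/2)%R) as [M1 H1]; [lra|].
  destruct (Hg (eps/2)%R) as [M2 H2]; [lra|]. exists (Z.max M1 M2). intros z Hz.
  generalize (Cmod_triangle (f z) (g z)) (H1 z ltac:(lia)) (H2 z ltac:(lia)). lra.
Qed.

Lemma vanishes_at_infinity_scal_l c f :
  vanishes_at_infinity f -> vanishes_at_infinity (fun z => c * f z).
Proof.
  intros Hf eps He. assert (Hc := Cmod_ge_0 c).
  destruct (Hf (eps / (Cmod c + 1))%R) as [M HM]; [apply Rdiv_lt_0_compat; lra|].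
  exists M. intros z Hz. rewrite Cmod_mult. specialize (HM z Hz).
  assert (Hf0 := Cmod_ge_0 (f z)).
  assert (E : ((Cmod c + 1) * (eps / (Cmod c + 1)) = eps)%R) by (field; lra).
  set (d := (eps / (Cmod c + 1))%R) in *. nra.
Qed.

Lemma vanishes_at_infinity_scal_r c f :
  vanishes_at_infinity f -> vanishes_at_infinity (fun z => f z * c).
Proof.
  intros H. apply (vanishes_at_infinity_le (fun z => c * f z)).
  - intros z. rewrite Cmult_comm. apply Rle_refl.
  - apply vanishes_at_infinity_scal_l; assumption.
Qed.

Lemma vanishes_at_infinity_fsum n (F : nat -> Z -> C) :
  (forall i, (i < n)%nat -> vanishes_at_infinity (F i)) ->
  vanishes_at_infinity (fun z => fsum n (fun i => F i z)).
Proof.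
  induction n as [|n IHn]; intros H.
  - intros eps He. exists 0%Z. intros. rewrite fsum_0, Cmod_0. assumption.
  - apply (vanishes_at_infinity_le (fun z => fsum n (fun i => F i z) + F n z)).
    + intros z. rewrite fsum_S. apply Rle_refl.
    + apply vanishes_at_infinity_plus; [apply IHn; intros; apply H|apply H]; lia.
Qed.

Lemma abs_summable_vanishes g : abs_summable_Z g -> vanishes_at_infinity g.
Proof.
  intros [H1 H2] eps He.
  apply ex_series_lim_0, is_lim_seq_spec in H1. apply ex_series_lim_0, is_lim_seq_spec in H2.
  destruct (H1 (mkposreal eps He)) as [N1 HN1]. destruct (H2 (mkposreal eps He)) as [N2 HN2].
  simpl in *. exists (Z.of_nat (N1 + N2)). intros z Hz.
  destruct (Z_le_gt_dec 0 z).
  - specialize (HN1 (Z.to_nat z) ltac:(lia)). rewrite Z2Nat.id in HN1 by lia.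
    rewrite Rminus_0_r, Rabs_pos_eq in HN1 by apply Cmod_ge_0. assumption.
  - specialize (HN2 (Z.to_nat (- z)) ltac:(lia)). rewrite Z2Nat.id, Z.opp_involutive in HN2 by lia.
    rewrite Rminus_0_r, Rabs_pos_eq in HN2 by apply Cmod_ge_0. assumption.
Qed.

Lemma vanishes_at_infinity_lim f (t : Z -> Z) : vanishes_at_infinity f ->
  (forall N : nat, Z.of_nat N <= Z.abs (t (Z.of_nat N)))%Z ->
  is_lim_Cseq (fun N => f (t (Z.of_nat N))) 0.
Proof.
  intros H Ht. apply is_lim_Cseq_Cmod_0, is_lim_seq_spec. intros eps.
  destruct (H eps (cond_pos eps)) as [M HM]. exists (Z.to_nat M). intros n Hn.
  rewrite Rminus_0_r, Rabs_pos_eq by apply Cmod_ge_0. apply HM.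
  specialize (Ht n). lia.
Qed.

(* Reindexings of Z that move the window [-N, N) only by its two boundary terms
   do not change the limit of the symmetric partial sums of a vanishing sequence. *)
Lemma is_lim_Cseq_boundary_change f h v : vanishes_at_infinity f ->
  (forall N, sym_partial h N = sym_partial f N - f (- Z.of_nat N)%Z + f (Z.of_nat N)) ->
  is_lim_Cseq (sym_partial f) v -> is_lim_Cseq (sym_partial h) v.
Proof.
  intros Hf E Hc. apply (is_lim_Cseq_ext (fun N => sym_partial f N + (-1) * f (- Z.of_nat N)%Z
                                                    + f (Z.of_nat N))).
  - intros N; rewrite E; ring.
  - replace v with (v + (-1) * 0 + 0) by ring.
    apply is_lim_Cseq_plus; [apply is_lim_Cseq_plus; [assumption|apply is_lim_Cseq_scal_l]|].
    + apply (vanishes_at_infinity_lim f Z.opp); [assumption|intros; lia].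
    + apply (vanishes_at_infinity_lim f (fun z => z)); [assumption|intros; lia].
Qed.

Lemma is_lim_Cseq_sym_partial_shift f v (j : nat) : vanishes_at_infinity f ->
  is_lim_Cseq (sym_partial f) v -> is_lim_Cseq (sym_partial (fun l => f (l + Z.of_nat j)%Z)) v.
Proof.
  intros Hf Hc. induction j as [|j IHj].
  - apply (is_lim_Cseq_ext (sym_partial f)); [|assumption].
    intros. apply sym_partial_ext. intros; f_equal; lia.
  - apply (is_lim_Cseq_boundary_change (fun l => f (l + Z.of_nat j)%Z));
      [apply vanishes_at_infinity_shift; assumption| |assumption].
    intros N. rewrite <- sym_partial_shift_1. apply sym_partial_ext. intros; f_equal; lia.
Qed.

Lemma is_lim_Cseq_sym_partial_reflect g v k : vanishes_at_infinity g ->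
  is_lim_Cseq (sym_partial g) v -> is_lim_Cseq (sym_partial (fun l => g (k - l)%Z)) v.
Proof.
  intros Hg Hc. destruct (Z_le_gt_dec 0 k) as [Hk|Hk].
  - apply (is_lim_Cseq_boundary_change (fun l => g (l + Z.of_nat (Z.to_nat k))%Z)).
    + apply vanishes_at_infinity_shift; assumption.
    + intros N. rewrite <- sym_partial_opp. apply sym_partial_ext. intros; f_equal; lia.
    + apply is_lim_Cseq_sym_partial_shift; assumption.
  - apply (is_lim_Cseq_ext (sym_partial (fun l => g (- (l + Z.of_nat (Z.to_nat (- k))))%Z))).
    + intros. apply sym_partial_ext. intros; f_equal; lia.
    + apply (is_lim_Cseq_sym_partial_shift (fun l => g (- l)%Z));
        [apply vanishes_at_infinity_opp; assumption|].
      apply (is_lim_Cseq_boundary_change g); [assumption|apply sym_partial_opp|assumption].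
Qed.

Lemma fsum_sum_n n (a : nat -> C) : fsum (S n) a = sum_n a n.
Proof.
  induction n as [|n IHn].
  - rewrite sum_O, fsum_S, fsum_0. apply Cplus_0_l.
  - rewrite sum_Sn, fsum_S, IHn. reflexivity.
Qed.

(* The symmetric partial sums pair the terms at [i] and [-i-1], and the resulting series
   converges absolutely in C. *)
Lemma is_lim_Cseq_sym_partial_dominated g h : abs_summable_Z g ->
  (forall m, (Cmod (h m) <= Cmod (g m))%R) ->
  is_lim_Cseq (sym_partial h) (zseries h).
Proof.
  intros [Hg1 Hg2] B.
  set (a := fun i => h (Z.of_nat i) + h (- Z.of_nat (S i))%Z).
  assert (Ha : ex_series a).
  { apply (ex_series_le a (fun i => Cmod (g (Z.of_nat i)) + Cmod (g (- Z.of_nat (S i))%Z))%R).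
    - intros n. eapply Rle_trans; [apply Cmod_triangle|]. apply Rplus_le_compat; apply B.
    - apply (ex_series_plus (fun i => Cmod (g (Z.of_nat i)))
                              (fun i => Cmod (g (- Z.of_nat (S i))%Z))); [assumption|].
      apply (ex_series_incr_1 (fun i => Cmod (g (- Z.of_nat i)%Z))). assumption. }
  destruct Ha as [v Hv].
  assert (Hlim : is_lim_Cseq (sym_partial h) v).
  { apply is_lim_Cseq_incr_1, (is_lim_Cseq_ext (sum_n a)).
    - intros n. rewrite sym_partial_pairs, fsum_sum_n. reflexivity.
    - apply is_lim_Cseq_filterlim, Hv. }
  rewrite (zseries_unique h v); [assumption|apply is_lim_Cseq_filterlim, Hlim].
Qed.

Section Eigen_kernel.

Variables (Rx : Z -> Z -> C) (P : nat) (sigma : R) (bp : nat -> C) (k : Z).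
Hypothesis HP : (0 < P)%nat.

Let HPr : (INR P <> 0)%R.
Proof. apply not_0_INR. lia. Qed.

Definition cyc_term (r c n : nat) (m : Z) : C :=
  Rx (Z.of_nat n) m * cexpi (- (2 * PI * (IZR (Z.of_nat r - Z.of_nat c) * INR n / INR P
                                          + (sigma + INR r / INR P) * IZR m))).

Lemma cyc_psd_mx_cyc_term r c :
  cyc_psd_mx Rx P sigma r c = RtoC (/ INR P) * fsum P (fun n => zseries (cyc_term r c n)).
Proof. reflexivity. Qed.

Definition wave (r : nat) : C := cexpi (2 * PI * (sigma + INR r / INR P) * IZR k).

(* The m-th term of sum_r e^{j 2 pi (sigma + r/P) k} [S_X(sigma) b]_r, with the
   lag series of every entry of S_X(sigma) opened up. *)
Definition psd_eigen_term (m : Z) : C :=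
  fsum P (fun r => fsum P (fun c =>
    (RtoC (/ INR P) * fsum P (fun n => cyc_term r c n m)) * bp c) * wave r).

Lemma Cmod_cyc_term r c n m : Cmod (cyc_term r c n m) = Cmod (Rx (Z.of_nat n) m).
Proof. unfold cyc_term. rewrite Cmod_mult, Cmod_cexpi. ring. Qed.

Hypothesis Habs : forall n : Z, abs_summable_Z (Rx n).

Lemma is_lim_Cseq_sym_partial_psd_eigen_term :
  is_lim_Cseq (sym_partial psd_eigen_term)
    (fsum P (fun r => fsum P (fun c => cyc_psd_mx Rx P sigma r c * bp c) * wave r)).
Proof.
  apply (is_lim_Cseq_ext (fun N => fsum P (fun r => fsum P (fun c =>
     (RtoC (/ INR P) * fsum P (fun n => sym_partial (cyc_term r c n) N)) * bp c) * wave r))).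
  - intros N. unfold psd_eigen_term. rewrite sym_partial_fsum. apply fsum_ext. intros r _.
    rewrite sym_partial_mult_r, sym_partial_fsum. f_equal. apply fsum_ext. intros c _.
    rewrite sym_partial_mult_r, sym_partial_mult_l, sym_partial_fsum. reflexivity.
  - apply is_lim_Cseq_fsum. intros r _. apply is_lim_Cseq_scal_r.
    apply is_lim_Cseq_fsum. intros c _. rewrite cyc_psd_mx_cyc_term.
    apply is_lim_Cseq_scal_r, is_lim_Cseq_scal_l, is_lim_Cseq_fsum. intros n _.
    apply (is_lim_Cseq_sym_partial_dominated (Rx (Z.of_nat n))); [apply Habs|].
    intros m. rewrite Cmod_cyc_term. apply Rle_refl.
Qed.

Lemma psd_eigen_term_vanishes : vanishes_at_infinity psd_eigen_term.
Proof.
  apply vanishes_at_infinity_fsum. intros r _. apply vanishes_at_infinity_scal_r.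
  apply vanishes_at_infinity_fsum. intros c _.
  apply vanishes_at_infinity_scal_r, vanishes_at_infinity_scal_l, vanishes_at_infinity_fsum.
  intros n _. apply (vanishes_at_infinity_le (Rx (Z.of_nat n))).
  - intros m. rewrite Cmod_cyc_term. apply Rle_refl.
  - apply abs_summable_vanishes, Habs.
Qed.

(* Phase bookkeeping: the r-dependence of the exponent is exactly a P-th root of unity
   raised to (k - m - n). *)
Lemma psd_eigen_term_expand m : psd_eigen_term m = fsum P (fun c => fsum P (fun n =>
    Rx (Z.of_nat n) m * bp c * cexpi (2 * PI * (sigma * IZR (k - m) + INR c * INR n / INR P)) *
    (RtoC (/ INR P) *
     fsum P (fun r => cexpi (2 * PI * INR r * IZR (k - m - Z.of_nat n) / INR P))))).
Proof.
  unfold psd_eigen_term.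
  rewrite (fsum_ext P _ (fun r => fsum P (fun c => fsum P (fun n =>
      ((RtoC (/ INR P) * cyc_term r c n m) * bp c) * wave r)))).
  - rewrite fsum_swap. apply fsum_ext. intros c _. rewrite fsum_swap. apply fsum_ext. intros n _.
    rewrite <- !fsum_mult_l. apply fsum_ext. intros r _. unfold cyc_term, wave.
    transitivity (RtoC (/ INR P) * Rx (Z.of_nat n) m * bp c *
      cexpi (- (2 * PI * (IZR (Z.of_nat r - Z.of_nat c) * INR n / INR P
                          + (sigma + INR r / INR P) * IZR m))
             + 2 * PI * (sigma + INR r / INR P) * IZR k)); [rewrite <- cexpi_add; ring|].
    transitivity (RtoC (/ INR P) * Rx (Z.of_nat n) m * bp c *
      cexpi (2 * PI * (sigma * IZR (k - m) + INR c * INR n / INR P)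
             + 2 * PI * INR r * IZR (k - m - Z.of_nat n) / INR P)); [|rewrite <- cexpi_add; ring].
    f_equal. f_equal. rewrite !minus_IZR, <- !INR_IZR_INZ. field. exact HPr.
  - intros r _. rewrite <- fsum_mult_r. apply fsum_ext. intros c _.
    rewrite <- fsum_mult_l, <- !fsum_mult_r. reflexivity.
Qed.

Hypothesis Hcs : cyclostationary Rx P.

Lemma psd_eigen_term_eq m : psd_eigen_term m = Rx (k - m)%Z m * phiCS bp P sigma (k - m).
Proof.
  rewrite psd_eigen_term_expand.
  rewrite (fsum_ext P _ (fun c => Rx (Z.of_nat (Z.to_nat ((k - m) mod Z.of_nat P))) m * bp c *
      cexpi (2 * PI * (sigma * IZR (k - m)
                       + INR c * INR (Z.to_nat ((k - m) mod Z.of_nat P)) / INR P))))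
    by (intros c _; apply (fsum_sift_residue P (k - m)
          (fun n => Rx (Z.of_nat n) m * bp c *
                    cexpi (2 * PI * (sigma * IZR (k - m) + INR c * INR n / INR P)))), HP).
  assert (HPz : (0 < Z.of_nat P)%Z) by lia.
  set (q := ((k - m) / Z.of_nat P)%Z).
  set (n0 := Z.to_nat ((k - m) mod Z.of_nat P)).
  assert (Hkm : (k - m = Z.of_nat n0 + q * Z.of_nat P)%Z).
  { unfold n0, q. rewrite Z2Nat.id by (apply Z.mod_pos_bound; lia).
    rewrite (Z.div_mod (k - m) (Z.of_nat P)) at 1 by lia. ring. }
  assert (HRx : Rx (k - m)%Z m = Rx (Z.of_nat n0) m) by (rewrite Hkm; apply Hcs).
  assert (Ekm : IZR (k - m) = (INR n0 + IZR q * INR P)%R).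
  { rewrite Hkm, plus_IZR, mult_IZR, <- !INR_IZR_INZ. reflexivity. }
  unfold phiCS. rewrite HRx, <- fsum_mult_l. apply fsum_ext. intros c _.
  rewrite <- (cexpi_periodic (2 * PI * (sigma * IZR (k - m) + INR c * INR n0 / INR P))
                             (Z.of_nat c * q)).
  replace (2 * PI * (sigma * IZR (k - m) + INR c * INR n0 / INR P)
           + 2 * PI * IZR (Z.of_nat c * q))%R
    with (2 * PI * (sigma + INR c / INR P) * IZR (k - m))%R; [ring|].
  rewrite Ekm, mult_IZR, <- INR_IZR_INZ. field. exact HPr.
Qed.

End Eigen_kernel.

Close Scope C_scope.

Theorem theorem1 :
  forall (Rx : Z -> Z -> C) (P : nat),
  (0 < P)%nat ->
  cyclostationary Rx P ->
  (forall n : Z, abs_summable_Z (Rx n)) ->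
  forall (sigma : R), 0 <= sigma < / INR P ->
  forall (b : nat -> nat -> C) (s : nat -> C),
  (forall p p' : nat, (p < P)%nat -> (p' < P)%nat ->
     fsum P (fun q => Cmult (b p q) (Cconj (b p' q))) =
     (if Nat.eqb p p' then RtoC 1 else RtoC 0)) ->
  (forall p r : nat, (p < P)%nat -> (r < P)%nat ->
     fsum P (fun c => Cmult (cyc_psd_mx Rx P sigma r c) (b p c)) =
     Cmult (s p) (b p r)) ->
  forall (p : nat), (p < P)%nat ->
  forall k : Z,
    zseries_to (fun l => Cmult (Rx l (k - l)%Z) (phiCS (b p) P sigma l))
               (Cmult (s p) (phiCS (b p) P sigma k)).
Proof.
  intros Rx P HP Hcs Habs sigma _ b s _ Heig p Hp k.
  assert (Hval : fsum P (fun r => fsum P (fun c => Cmult (cyc_psd_mx Rx P sigma r c) (b p c))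
                                  * wave P sigma k r)%C
                 = Cmult (s p) (phiCS (b p) P sigma k)).
  { unfold phiCS, wave. rewrite <- fsum_mult_l. apply fsum_ext. intros r Hr.
    rewrite Heig by assumption. symmetry. apply Cmult_assoc. }
  apply is_lim_Cseq_filterlim. rewrite <- Hval.
  apply (is_lim_Cseq_ext (sym_partial (fun l => psd_eigen_term Rx P sigma (b p) k (k - l)))).
  - intros N. apply sym_partial_ext. intros l.
    rewrite psd_eigen_term_eq by assumption. f_equal; f_equal; ring.
  - apply is_lim_Cseq_sym_partial_reflect.
    + apply psd_eigen_term_vanishes. assumption.
    + apply is_lim_Cseq_sym_partial_psd_eigen_term. assumption.
Qed.
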